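(* Let $S$ be a cancellative commutative locally compact pseudocompact Hausdorff topological semigroup with open shifts. Then $S$ is an open dense subsemigroup of $\langle S\rangle^{\ast}$ (that is, $\iota\colon S\to\langle S\rangle^{\ast}$ is a homeomorphism onto its image, and $\iota(S)$ is an open dense subsemigroup of $\langle S\rangle^{\ast}$), and $\langle S\rangle^{\ast}$ is a compact topological group.
   Context: A topological semigroup is a nonempty set $S$ with an associative operation and a topology (no separation axiom assumed unless stated) such that the operation $S\times S\to S$ is jointly continuous. It has open shifts if for every $a\in S$ and every open $U\subseteq S$ the sets $aU$ and $Ua$ are open in $S$. A space is locally compact if each point has a compact neighborhood. A (Tychonoff) space is pseudocompact if every continuous real-valued function on it is bounded. For a cancellative commutative semigroup $S$, define on $S\times S$ (with coordinatewise operation) the congruence $(x,y)\,\mathcal R\,(a,b)$ iff $xb=ya$; let $\langle S\rangle=(S\times S)/\mathcal R$ with the induced operation and let $\pi\colon S\times S\to\langle S\rangle$ be the quotient map. Then $\langle S\rangle$ is an abelian group (neutral element $\pi(x,x)$, inverse of $\pi(a,b)$ is $\pi(b,a)$), and $\iota\colon S\to\langle S\rangle$, $\iota(x)=\pi(xa,a)$ (independent of the choice of $a\in S$), is an injective homomorphism, by which $S$ is identified with its image, so that $\langle S\rangle=SS^{-1}$. If $S$ is a topological semigroup, $\langle S\rangle^{\ast}$ denotes $\langle S\rangle$ with the quotient topology induced by $\pi$, where $S\times S$ carries the product topology. *)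

(* Defs.v *)
From HB Require Import structures.
From mathcomp Require Import all_boot all_order all_algebra.
From mathcomp Require Import all_classical all_reals all_analysis.

Set Implicit Arguments.
Unset Strict Implicit.
Unset Printing Implicit Defensive.

Import numFieldNormedType.Exports.

Local Open Scope classical_set_scope.
Local Open Scope quotient_scope.
Local Open Scope group_scope.

(* Topological semigroups are nonempty, whereas [semigroupType] allows an empty
   carrier. *)

HB.mixin Record Semigroup_isNonempty S of Semigroup S := {
  semigroup_nonempty : exists x : S, xpredT x
}.

#[short(type="nonemptySemigroupType")]
HB.structure Definition NonemptySemigroup :=
  {S of Semigroup S & Semigroup_isNonempty S}.

HB.mixin Record Semigroup_isCancellativeCommutative S of Semigroup S := {
  smulC : forall x y : S, x * y = y * x;
  smulIs : forall z x y : S, x * z = y * z -> x = y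
}.

#[short(type="ccSemigroupType")]
HB.structure Definition CCSemigroup :=
  {S of NonemptySemigroup S & Semigroup_isCancellativeCommutative S}.

HB.structure Definition PreTopologicalSemigroup :=
  {S of Semigroup S & Topological S}.

HB.mixin Record PreTopologicalSemigroup_isTopologicalSemigroup S
    of PreTopologicalSemigroup S := {
  smul_continuous : continuous (fun p : S * S => p.1 * p.2)
}.

#[short(type="topologicalSemigroupType")]
HB.structure Definition TopologicalSemigroup :=
  {S of PreTopologicalSemigroup S & NonemptySemigroup S
      & PreTopologicalSemigroup_isTopologicalSemigroup S}.

#[short(type="ccTopologicalSemigroupType")]
HB.structure Definition CCTopologicalSemigroup :=
  {S of TopologicalSemigroup S & CCSemigroup S}.

#[short(type="preTopologicalGroupType")]
HB.structure Definition PreTopologicalGroup := {G of Group G & Topological G}.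

Definition topological_group (G : preTopologicalGroupType) : Prop :=
  continuous (fun p : G * G => p.1 * p.2) /\ continuous (fun x : G => x^-1).

Definition open_shifts (S : topologicalSemigroupType) : Prop :=
  forall (a : S) (U : set S), open U ->
    open [set a * x | x in U] /\ open [set x * a | x in U].

(* No Tychonoff clause: it is automatic for locally compact Hausdorff spaces,
   see [locally_compact_completely_regular]. *)
Definition pseudocompact (R : realType) (X : topologicalType) : Prop :=
  forall f : X -> R, continuous f -> bounded_fun f.

(* [{within A, continuous g}] is continuity of the restriction of [g] to [A]
   for the subspace topology of [A]; the values of [g] outside the range of
   [f] are irrelevant. *)
Definition homeomorphism_onto_image (X Y : topologicalType) (f : X -> Y) :
    Prop :=
  continuous f /\
  exists g : Y -> X, cancel f g /\ {within range f, continuous g}.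

Definition subsemigroup (G : semigroupType) (A : set G) : Prop :=
  A !=set0 /\ (forall x y, A x -> A y -> A (x * y)).

(* In a Hausdorff space, [locally_compact], which asks for compact and closed
   neighborhoods, only requires compact ones. *)
Lemma locally_compactTP (X : topologicalType) : hausdorff_space X ->
  locally_compact [set: X] <->
  (forall x : X, exists2 K : set X, nbhs x K & compact K).
Proof.
move=> hX; split=> H x.
  have [K nK [cK _]] := H x I; exists K => //.
  by move: nK; rewrite /within /=; apply: filterS => y; exact.
move=> _; have [K nK cK] := H x; exists K.
  by rewrite /within /=; apply: filterS nK => y Ky _.
by split => //; exact: compact_closed.
Qed.

Section Fractions.
Variable S : ccSemigroupType.
Implicit Types p q : (S * S)%type.

(* [p.1, p.2] stands for the fraction p.1 * p.2^-1. *)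
Definition frac_rel p q := p.1 * q.2 == p.2 * q.1.

Fact frac_rel_refl : reflexive frac_rel.
Proof. by move=> p; rewrite /frac_rel smulC. Qed.

Fact frac_rel_sym : symmetric frac_rel.
Proof.
by move=> p q; rewrite /frac_rel eq_sym smulC [X in _ == X]smulC.
Qed.

Fact frac_rel_trans : transitive frac_rel.
Proof.
move=> [x y] [a b] [c d]; rewrite /frac_rel /= => /eqP aybx /eqP xdyc.
apply/eqP/(@smulIs _ y).
by rewrite -!mulgA (smulC d) (mulgA a) aybx -mulgA xdyc (smulC c).
Qed.

Canonical frac_equiv :=
  EquivRel frac_rel frac_rel_refl frac_rel_sym frac_rel_trans.

Definition fractions : Type := {eq_quot frac_rel}.

HB.instance Definition _ := EqQuotient.copy fractions {eq_quot frac_rel}.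
HB.instance Definition _ := Choice.copy fractions {eq_quot frac_rel}.

Lemma frac_piP p q :
  \pi_fractions p = \pi_fractions q <-> p.1 * q.2 = p.2 * q.1.
Proof. by split => [/eqquotP/eqP //|pq]; apply/eqquotP/eqP. Qed.

Definition frac_mul : fractions -> fractions -> fractions :=
  lift_op2 fractions (fun p q => p * q).
Definition frac_inv : fractions -> fractions :=
  lift_op1 fractions (fun p => (p.2, p.1)).
(* The choice of [a] is immaterial in [frac_one] and in [frac_iota] below, see
   [frac_oneE] and [frac_iotaE]. *)
Definition frac_one : fractions :=
  let a := xchoose (@semigroup_nonempty S) in \pi_fractions (a, a).

Let smulACA (a b c d : S) : a * b * (c * d) = a * c * (b * d).
Proof. by rewrite -!mulgA; congr (_ * _); rewrite mulgA (smulC b) mulgA. Qed.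

Lemma frac_mulE p q : frac_mul (\pi_fractions p) (\pi_fractions q) = \pi_fractions (p * q).
Proof.
rewrite /frac_mul; unlock; apply/frac_piP.
have /frac_piP Hp : \pi_fractions (repr (\pi_fractions p)) = \pi_fractions p.
  by rewrite reprK.
have /frac_piP Hq : \pi_fractions (repr (\pi_fractions q)) = \pi_fractions q.
  by rewrite reprK.
by rewrite /= smulACA Hp Hq smulACA.
Qed.

Lemma frac_invE p : frac_inv (\pi_fractions p) = \pi_fractions (p.2, p.1).
Proof.
rewrite /frac_inv; unlock; apply/frac_piP => /=.
have /frac_piP Hp : \pi_fractions (repr (\pi_fractions p)) = \pi_fractions p.
  by rewrite reprK.
by rewrite -Hp.
Qed.

Lemma frac_oneE x : frac_one = \pi_fractions (x, x).
Proof. by apply/frac_piP. Qed.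

Fact frac_mulA : associative frac_mul.
Proof.
move=> u v w; rewrite -[u]reprK -[v]reprK -[w]reprK.
by rewrite !frac_mulE mulgA.
Qed.

Fact frac_mulC : commutative frac_mul.
Proof.
move=> u v; rewrite -[u]reprK -[v]reprK !frac_mulE; congr \pi_fractions.
by case: (repr u) (repr v) => [a b] [c d]; congr (_, _); exact: smulC.
Qed.

Fact frac_mul1g : left_id frac_one frac_mul.
Proof.
move=> u; rewrite -[u]reprK; case: (repr u) => a b.
rewrite (frac_oneE a) frac_mulE; apply/frac_piP => /=.
by rewrite -!mulgA (smulC b).
Qed.

Fact frac_mulg1 : right_id frac_one frac_mul.
Proof. by move=> u; rewrite frac_mulC frac_mul1g. Qed.

Fact frac_mulVg : left_inverse frac_one frac_inv frac_mul.
Proof.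
move=> u; rewrite -[u]reprK; case: (repr u) => a b.
rewrite (frac_oneE (a * b)) frac_invE frac_mulE; apply/frac_piP => /=.
by rewrite (smulC b).
Qed.

Fact frac_mulgV : right_inverse frac_one frac_inv frac_mul.
Proof. by move=> u; rewrite frac_mulC frac_mulVg. Qed.

HB.instance Definition _ := isGroup.Build fractions
  frac_mulA frac_mul1g frac_mulg1 frac_mulVg frac_mulgV.

Definition frac_iota (x : S) : fractions :=
  let a := xchoose (@semigroup_nonempty S) in \pi_fractions (x * a, a).

Lemma frac_iotaE (a x : S) : frac_iota x = \pi_fractions (x * a, a).
Proof.
apply/frac_piP => /=.
by rewrite mulgA (smulC (xchoose _) x).
Qed.

Lemma frac_iotaM : {morph frac_iota : x y / x * y}.
Proof.
move=> x y; set a := xchoose (@semigroup_nonempty S).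
rewrite (frac_iotaE (a * a)) (frac_iotaE a x) (frac_iotaE a y).
by rewrite [RHS]frac_mulE; congr (\pi_fractions (_, _)); rewrite smulACA.
Qed.

Lemma frac_iota_inj : injective frac_iota.
Proof.
move=> x y; set a := xchoose (@semigroup_nonempty S).
rewrite (frac_iotaE a x) (frac_iotaE a y) => /frac_piP /= h; apply/(@smulIs _ (a * a)).
by rewrite mulgA h mulgA (smulC a y) mulgA.
Qed.

End Fractions.

Section TopologicalFractions.
Variable S : ccTopologicalSemigroupType.

Definition topFractions : Type := quotient_topology (fractions S).

HB.instance Definition _ := Topological.on topFractions.
HB.instance Definition _ := Quotient.on topFractions.
HB.instance Definition _ := isGroup.Build topFractions
  (@frac_mulA S) (@frac_mul1g S) (@frac_mulg1 S) (@frac_mulVg S) (@frac_mulgV S).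

Definition topFrac_iota : S -> topFractions := @frac_iota S.

Lemma open_topFractionsE (U : set topFractions) :
  open U = open (\pi_topFractions @^-1` U : set (S * S)).
Proof. by []. Qed.

End TopologicalFractions.

(* Main.v *)
Require Import Defs.
From HB Require Import structures.
From mathcomp Require Import all_boot all_order all_algebra.
From mathcomp Require Import all_classical all_reals all_analysis.
Set Implicit Arguments.
Unset Strict Implicit.
Unset Printing Implicit Defensive.
Local Open Scope classical_set_scope.
Local Open Scope quotient_scope.
Local Open Scope group_scope.

(** The map [topFrac_iota] always is a continuous injective homomorphism, and
    [topFractions S] is a topological group as soon as the projection
    [\pi : S * S -> topFractions S] is open, which follows from the open shifts
    ([pi_topFractions_open]).

    That [topFrac_iota] is open is a form of Ellis's theorem. Let u be a point
    of S. The neighborhoods of u, divided by u, would be the neighborhoods of 1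
    in the group of fractions if S were open there; multiplication is continuous
    for them, and one needs that inversion is continuous at 1
    ([inv_nbhs]). If it is not, there are x_0, x_1, ... converging to 1 so fast
    that the infinite products x_k x_(k+1) ... stay in small compact
    neighborhoods V_k of 1, while the inverses of the x_k avoid a fixed
    neighborhood of 1. The partial products p_k cluster at some p with
    p_k^-1 p in V_k, and 1 / x_k = (p_k / p) (p / p_(k+1)) is then small for
    some k, a contradiction.

    Pseudocompactness enters through one consequence: in every sequence u_n of
    S, and for every neighborhood N of 1 in the group, there are i < j with
    u_j / u_i in N ([topFrac_close_terms]). Otherwise the translates of a small
    neighborhood of 1 centered at the u_n form a locally finite disjoint family,
    and a sum of bump functions of increasing heights supported by them is
    continuous and unbounded ([pseudocompact_accumulation]). Applied to the odd
    powers of t in S this gives w in S with t w close to 1, so that every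
    fraction s / t is approximated by elements w s of S: the range of
    [topFrac_iota] is dense. Applied to a sequence chosen greedily it shows that
    S is covered by finitely many translates of any neighborhood of 1. By
    density the same holds for the whole group, and as the neighborhood can be
    taken inside a translate of a compact subset of S, the group is compact. *)

(** * Permuting factors in a commutative semigroup *)

Lemma smulA_pull (S : ccSemigroupType) (h t x t' : S) :
  t = x * t' -> h * t = x * (h * t').
Proof. by move->; rewrite !mulgA (smulC h). Qed.

(** [smul_pull x l] is a proof of [l = x * l'], for a right-associated product
    [l] containing the factor [x]. *)
Ltac smul_pull x l :=
  lazymatch l with
  | (x * ?t)%g => constr:(erefl l)
  | (?h * x)%g => constr:(smulC h x)
  | (?h * ?t)%g => let p := smul_pull x t in constr:(smulA_pull h p)
  end.

Ltac smul_ac :=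
  rewrite -?mulgA;
  repeat (lazymatch goal with
    |- ?l = (?x * _)%g =>
      let p := smul_pull x l in
      refine (etrans p _); refine (congr1 ( *%g x) _)
    end);
  reflexivity.

(** * Open shifts and inverses in a locally compact semigroup *)

Section Shifts.
Variable S : ccTopologicalSemigroupType.

Lemma smulI (z x y : S) : z * x = z * y -> x = y.
Proof. by rewrite !(smulC z); exact: smulIs. Qed.

Lemma smul_nbhs (a b : S) (A : set S) : nbhs (a * b) A ->
  exists P Q, [/\ nbhs a P, nbhs b Q & forall x y, P x -> Q y -> A (x * y)].
Proof.
move=> /(@smul_continuous S (a, b))[[P Q] [/= aP bQ] PQA].
by exists P, Q; split => // x y Px Qy; exact: (PQA (x, y)).
Qed.

Lemma smull_continuous (a : S) : continuous (fun x => a * x).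
Proof.
move=> b A /smul_nbhs[P [Q [aP bQ PQA]]]; apply: filterS bQ => y Qy.
exact: PQA (nbhs_singleton aP) Qy.
Qed.

Hypothesis oS : open_shifts S.

Lemma shift_nbhs (a x : S) (U : set S) : nbhs x U ->
  nbhs (a * x) [set a * u | u in U].
Proof.
rewrite nbhsE => -[B [oB Bx] BU]; rewrite nbhsE; exists [set a * u | u in B].
  by split; [have [] := oS a oB|exists x].
exact: image_subset.
Qed.

(** If [s / a * w = t], then for [t'] near [t] the quotient [t' / (s / a)]
    exists in S and is near [w]: this is how open shifts are used to divide. *)
Lemma div_nbhs (s w a t : S) (W : set S) : s * w = a * t -> nbhs w W ->
  nbhs t [set t | exists2 w, W w & s * w = a * t].
Proof.
move=> swat /(shift_nbhs s); rewrite swat => sW.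
have : nbhs t [set y | [set s * u | u in W] (a * y)].
  exact: (@smull_continuous a t).
by apply: filterS => y [x Wx sxay]; exists x.
Qed.

(** Continuity of the multiplication of the fractions x / a at (1, 1): a product
    (x / a) (y / a) near 1 is again of the form z / a, as [a] S is open. *)
Lemma square_nbhs (a : S) (V : set S) : nbhs a V ->
  exists2 W, nbhs a W &
    forall x y, W x -> W y -> exists2 z, V z & x * y = a * z.
Proof.
move=> /(shift_nbhs a)/smul_nbhs[P [Q [aP aQ PQ]]].
exists (P `&` Q); first exact: filterI.
by move=> x y [Px _] [_ Qy]; have [z Vz <-] := PQ _ _ Px Qy; exists z.
Qed.

Hypothesis hS : hausdorff_space S.
Hypothesis lS : locally_compact [set: S].

Lemma compact_nbhs (a : S) (V : set S) : nbhs a V ->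
  exists2 K, nbhs a K & compact K /\ K `<=` V.
Proof.
move=> aV; have [K aK cK] := (locally_compactTP hS).1 lS a.
have [C aC CV] := compact_regular hS cK aK aV.
exists (closure C `&` K).
  by apply: filterI => //; apply: filterS aC; exact: subset_closure.
split; last by move=> x [/CV].
rewrite setIC; apply: compact_closedI => //; exact: closed_closure.
Qed.

Lemma compact_square_nbhs (a : S) (V : set S) : nbhs a V ->
  exists W, [/\ nbhs a W, compact W &
    forall x y, W x -> W y -> exists2 z, V z & x * y = a * z].
Proof.
move=> /square_nbhs[W' aW' W'V]; have [W aW [cW WW']] := compact_nbhs aW'.
by exists W; split => // x y /WW' Wx /WW' Wy; exact: W'V.
Qed.

(** Continuity of the inversion of the fractions x / a at 1, by the argument of
    Ellis's theorem on locally compact semigroups. All fractions below have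
    denominator [a], so that a product z = x y of fractions reads
    [x * y = a * z]. *)
Lemma inv_nbhs (a : S) (U : set S) : nbhs a U ->
  exists2 V, nbhs a V & forall x, V x -> exists2 u, U u & u * x = a * a.
Proof.
move=> aU; apply: contrapT => noV.
have bad V : nbhs a V -> exists2 x, V x & forall u, U u -> u * x <> a * a.
  move=> aV; apply: contrapT => nox; apply: noV; exists V => // x Vx.
  apply: contrapT => nou; apply: nox; exists x => // u Uu uxaa.
  by apply: nou; exists u.
have [K0 aK0 [cK0 K0U]] := compact_nbhs aU.
pose good V W := nbhs a V -> [/\ nbhs a W, compact W &
    forall x y, W x -> W y -> exists2 z, V z & x * y = a * z].
have [next nextP] : {next & forall V, good V (next V)}.
  apply: choice => V; rewrite /good.
  have [/compact_square_nbhs[W W_]|nV] := pselect (nbhs a V); first by exists W.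
  by exists V.
pose V n := iter n next K0.
have aV n : nbhs a (V n) by elim: n => //= n /nextP[].
have cV n : compact (V n) by case: n => [//|n]; have [] := nextP _ (aV n).
have VV n x y : V n.+1 x -> V n.+1 y -> exists2 z, V n z & x * y = a * z.
  by have [_ _] := nextP _ (aV n); exact.
have Va n : V n a by exact: nbhs_singleton.
have Vdec n : V n.+1 `<=` V n.
  by move=> x /VV/(_ (Va n.+1))[z Vz]; rewrite smulC => /smulI ->.
have V1 n : V n.+1 `<=` V 1%N.
  by elim: n => // n IH x /Vdec; exact: IH.
have [x xP] : {x : nat -> S & forall n,
    V n.+1 (x n) /\ forall u, U u -> u * x n <> a * a}.
  apply: (@choice _ _ (fun n y => V n.+1 y /\ forall u, U u -> u * y <> a * a)).
  by move=> n; have [y Vy Uy] := bad _ (aV n.+1); exists y.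
(* [T k m] is the product of the [m] fractions from [x k] on; it lies in [V k]
   because the product of the last ones lies in [V k.+1]. *)
pose quo y z := xget a [set t | y * z = a * t].
have [T [T0 TS TV]] : exists T : nat -> nat -> S, [/\ forall k, T k 0%N = a,
    forall k m, a * T k m.+1 = x k * T k.+1 m & forall k m, V k (T k m)].
  pose fix T k m := if m is m'.+1 then quo (x k) (T k.+1 m') else a.
  have TV m : forall k, V k (T k m).
    elim: m => [k|m IH k]; first exact: Va.
    have [z Vz xTz] := VV _ _ _ (xP k).1 (IH k.+1).
    rewrite /= /quo; case: xgetP => [t -> /=|/(_ z)//].
    by rewrite xTz => /smulI <-.
  exists T; split => // k m.
  have [z Vz xTz] := VV _ _ _ (xP k).1 (TV m k.+1).
  by rewrite /= /quo; case: xgetP => [t -> /=|/(_ z)//].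
have T1 k : T k 1%N = x k by apply: (@smulI a); rewrite TS T0 smulC.
have Tcat k : forall j m, a * T j (k + m)%N = T j k * T (j + k)%N m.
  elim: k => [j m|k IH j m]; first by rewrite T0 addn0.
  apply: (@smulI a); rewrite addSn TS [RHS]mulgA TS.
  rewrite -addSnnS -[RHS]mulgA -IH; smul_ac.
(* [s n] is the n-th partial product, and [p] a cluster point. *)
pose s n := T 0%N n.
have sV : (s @ \oo) (V 0%N) by exists 0%N => // n _; exact: TV.
have [p [_ clp]] := cV 0%N (s @ \oo) _ sV.
(* The tail products [s n / s k] lie in [V k] for n >= k, hence so does
   [p / s k], since [s k * V k] is compact and thus closed. *)
have pP k : exists2 v, V k v & a * p = s k * v.
  have cC : closed [set t | [set s k * v | v in V k] (a * t)].
    apply: (@preimage_closed _ _ (fun t => a * t)).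
      by move=> ? _; exact: smull_continuous.
    apply: compact_closed hS _; apply: continuous_compact (cV k).
    by apply: continuous_subspaceT; exact: smull_continuous.
  suff /cC : closure [set t | [set s k * v | v in V k] (a * t)] p.
    by case=> v Vv <-; exists v.
  move: clp; rewrite clusterE; apply.
  exists k => // n /= kn; rewrite -(subnKC kn) /s Tcat.
  by exists (T (0 + k)%N (n - k)%N).
(* Some [s k / p] lies in [V 1], by clustering. *)
have [k [w Vw pw]] : exists k, exists2 w, V 1%N w & p * w = a * s k.
  have pW : nbhs p [set t | exists2 w, V 1%N w & p * w = a * t].
    exact: div_nbhs (smulC _ _) (aV 1%N).
  have [|t [[k _ <-] ?]] := clp [set s n | n in setT] _ _ pW.
    by exists 0%N => // n _; exists n.
  by exists k.
have [v /V1 Vv pv] := pP k.+1.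
have [u Vu wv] := VV _ _ _ Vw Vv.
have sS : a * s k.+1 = s k * x k by rewrite /s -addn1 Tcat T1.
(* 1 / x k = (s k / p) * (p / s k.+1) = w * v = u. *)
apply: ((xP k).2 u (K0U _ Vu)).
apply: (@smulI (a * p * s k * s k.+1)).
transitivity ((p * w) * (s k.+1 * v) * (s k * x k)).
  transitivity (p * s k * s k.+1 * (w * v) * x k); last by smul_ac.
  by rewrite wv; smul_ac.
by rewrite pw -pv -sS; smul_ac.
Qed.

End Shifts.

(** * The topological group of fractions *)

Section Fractions.
Variable S : ccTopologicalSemigroupType.
Local Notation G := (topFractions S).
Local Notation iota := (@topFrac_iota S).

Lemma topFrac_mulC (g h : G) : g * h = h * g.
Proof. exact: frac_mulC. Qed.

Lemma topFrac_divKr (z g h : G) : (z / h) / (z / g) = g / h.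
Proof. by rewrite invgF topFrac_mulC divgKA. Qed.

Lemma topFrac_iotaM (x y : S) : iota (x * y) = iota x * iota y.
Proof. exact: frac_iotaM. Qed.

Lemma pi_topFractionsE (x y : S) : \pi_G (x, y) = iota x / iota y.
Proof.
have piM p q : \pi_G (p * q) = \pi_G p * \pi_G q by rewrite -frac_mulE.
have piV p : \pi_G (p.2, p.1) = (\pi_G p)^-1 by rewrite -frac_invE.
rewrite /topFrac_iota (frac_iotaE x) (frac_iotaE x y) -/(\pi_G _).
rewrite -(piV (y * x, x)) -piM; apply/frac_piP => /=; smul_ac.
Qed.

Lemma topFracP (g : G) : exists x y : S, g = iota x / iota y.
Proof.
exists (repr g).1, (repr g).2.
by rewrite -pi_topFractionsE -surjective_pairing reprK.
Qed.

Lemma topFrac_eq (x y x' y' : S) :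
  iota x / iota y = iota x' / iota y' <-> x * y' = y * x'.
Proof. by rewrite -!pi_topFractionsE; exact: frac_piP. Qed.

Lemma topFrac_iota_eq (z x y : S) : iota z = iota x / iota y <-> z * y = x.
Proof.
rewrite -[iota z](mulgK (iota y)) -topFrac_iotaM topFrac_eq.
by rewrite (smulC y); split => [/smulIs|->].
Qed.

Lemma pi_topFractions_continuous : continuous (\pi_G : S * S -> G).
Proof. exact: pi_continuous. Qed.

Lemma topFrac_iota_continuous : continuous iota.
Proof.
move=> x; have -> : iota = \pi_G \o (fun y => (y * x, x)).
  by apply/funext => y; exact: frac_iotaE.
apply: continuous_comp; last exact: pi_topFractions_continuous.
apply: cvg_pair; last exact: cvg_cst.
move=> /= A; rewrite smulC => /(@smull_continuous S x x).
by rewrite /nbhs /= /fmap /=; under eq_fun do rewrite smulC.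
Qed.

Hypothesis oS : open_shifts S.

(** If x / y = a / b with (x, y) in [U], and (a', b') is near (a, b), then
    x' = x (a' / a) and y' = y (b' / b) exist by [div_nbhs], (x', y') is in [U]
    and x' / y' = a' / b'. *)
Lemma pi_topFractions_open (U : set (S * S)) : open U -> open (\pi_G @` U).
Proof.
move=> oU; rewrite open_topFractionsE openE => -[a b] [[x y] Uxy].
rewrite !pi_topFractionsE => /topFrac_eq /= xbya.
have [[P Q] [/= xP yQ] PQU] : nbhs (x, y) U by exact: open_nbhs_nbhs.
exists ([set t | exists2 w, P w & a * w = x * t],
        [set t | exists2 w, Q w & b * w = y * t]).
  by split; exact: (div_nbhs oS (smulC _ _)).
move=> [a' b'] [/= [x' Px' ax'] [y' Qy' by']].
exists (x', y'); first exact: PQU.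
rewrite !pi_topFractionsE; apply/topFrac_eq; apply: (@smulI _ (a * b * y)).
transitivity ((a * x') * b * (y * b')); first by smul_ac.
rewrite ax' -by'; transitivity ((x * b) * a' * b * y'); first by smul_ac.
by rewrite xbya; smul_ac.
Qed.

(** The product of two quotient maps need not be one, hence the recourse to the
    openness of [\pi] for the multiplication. *)
Lemma topFrac_topological_group : topological_group G.
Proof.
have pi_nbhs p P : nbhs p P -> nbhs (\pi_G p) (\pi_G @` P).
  rewrite nbhsE => -[B [oB Bp] BP]; rewrite nbhsE; exists (\pi_G @` B).
    by split; [exact: pi_topFractions_open|exists p].
  exact: image_subset.
split=> [[g h] A|].
  rewrite -[g]reprK -[h]reprK /=; move: (repr g) (repr h) => p q pqA.
  have : nbhs (p * q) (\pi_G @^-1` A).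
    by apply: pi_topFractions_continuous; rewrite -frac_mulE.
  move=> [[A1 A2] [/= /smul_nbhs[P1 [Q1 [pP1 qQ1 PQ1]]]]].
  move=> /smul_nbhs[P2 [Q2 [pP2 qQ2 PQ2]]] AA.
  exists (\pi_G @` (P1 `*` P2), \pi_G @` (Q1 `*` Q2)).
    split; apply: pi_nbhs.
      by exists (P1, P2).
    by exists (Q1, Q2).
  move=> [_ _] [/= [p' [P1p P2p] <-] [q' [Q1q Q2q] <-]].
  suff : A (\pi_G (p' * q')) by rewrite -frac_mulE.
  by apply: AA; split; [exact: PQ1|exact: PQ2].
apply/quotient_continuous => p A pA.
have : nbhs (p.2, p.1) (\pi_G @^-1` A).
  by apply: pi_topFractions_continuous; rewrite -frac_invE.
move=> [[P Q] [/= pP pQ] PQA]; exists (Q, P) => //.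
move=> q [/= Qq Pq]; suff : A (\pi_G (q.2, q.1)) by rewrite -frac_invE.
exact: PQA.
Qed.

Hypothesis hS : hausdorff_space S.
Hypothesis lS : locally_compact [set: S].

(** Let (x', y') be near (x, y), where x / y = u. Then x' = v y with v near u,
    and y' = (w / u) y with w near u. So x' / y' = v u / w, where
    u / w = r / u with r near u by [inv_nbhs]. *)
Lemma topFrac_iota_open (U : set S) : open U -> open (iota @` U).
Proof.
move=> oU; rewrite open_topFractionsE openE => -[x y] [u Uu].
rewrite pi_topFractionsE => /topFrac_iota_eq uyx.
have uU : nbhs u U by exact: open_nbhs_nbhs.
have [V uV VU] := square_nbhs oS uU.
have [W uW WV] := inv_nbhs oS hS lS uV.
exists ([set t | exists2 v, V v & y * y * v = y * t],
        [set t | exists2 w, W w & y * w = u * t]).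
  split; last exact: (div_nbhs oS (smulC _ _)).
  by apply: (div_nbhs oS _ uV); rewrite /= -uyx; smul_ac.
move=> [x' y'] [/= [v Vv]]; rewrite -mulgA => /smulI <- [w Ww yw].
have [r Vr rw] := WV _ Ww; have [z Uz vr] := VU _ _ Vv Vr.
exists z => //; rewrite pi_topFractionsE; apply/topFrac_iota_eq.
apply: (@smulI _ (u * u)); transitivity (u * z * (u * y')); first by smul_ac.
rewrite -yw -vr; transitivity (r * w * v * y); first by smul_ac.
by rewrite rw; smul_ac.
Qed.

Lemma topFrac_iota_homeomorphism : homeomorphism_onto_image iota.
Proof.
split; first exact: topFrac_iota_continuous.
have a := xchoose (@semigroup_nonempty S).
have iota_inj : injective iota by exact: frac_iota_inj.
pose g h := xget a [set x | iota x = h].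
have iotaK : cancel iota g.
  move=> x; rewrite /g.
  by case: xgetP => [y _ /= /iota_inj //|/(_ x)/(_ erefl)].
exists g; split => //; apply/subspace_continuousP => _ [x _ <-].
rewrite /from_subspace iotaK => A.
rewrite nbhsE => -[B [oB Bx] BA].
suff : nbhs (iota x) [set h | range iota h -> A (g h)] by [].
rewrite nbhsE; exists (iota @` B).
  by split; [exact: topFrac_iota_open|exists x].
by move=> _ [y By <-] _; rewrite /= iotaK; exact: BA.
Qed.

End Fractions.

(** * Pseudocompactness and locally finite families *)

Import Order.TTheory GRing.Theory Num.Theory.
Import numFieldNormedType.Exports.

Section Pseudocompact.
Local Open Scope ring_scope.
Variables (R : realType) (X : topologicalType).
Hypothesis crX : completely_regular_space X.
Hypothesis pcX : pseudocompact R X.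

(** Otherwise the [W n] are disjoint and locally finite, and the sum of bump
    functions of height [n] at [u n] supported by [W n] is continuous and
    unbounded. *)
Lemma pseudocompact_accumulation (u : nat -> X) (W : nat -> set X) :
  (forall n, nbhs (u n) (W n)) ->
  exists p : X, forall M, nbhs p M ->
    exists i j x y, [/\ (i < j)%N, M x /\ M y, W i x & W j y].
Proof.
move=> uW; apply: contrapT => noacc.
have sep (p : X) : exists2 M, nbhs p M &
    forall i j x y, M x -> M y -> W i x -> W j y -> i = j.
  apply: contrapT => noM; apply: noacc; exists p => M pM.
  apply: contrapT => noij; apply: noM; exists M => // i j x y Mx My Wx Wy.
  case: (ltngtP i j) => // ij; case: noij.
    by exists i, j, x, y.
  by exists j, i, y, x.
have [f fP] : {f : nat -> X -> R & forall n, [/\ continuous (f n), f n (u n) = 0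
    & forall x, ~ W n x -> f n x = 1]}.
  apply: (@choice _ _ (fun n (f : X -> R) => [/\ continuous f, f (u n) = 0
    & forall x, ~ W n x -> f x = 1])) => n.
  have [|/= |f [cf _ f0 f1]] := (@uniform_separatorP _ R _ _).1
      (crX (a := u n) (B := ~` (W n)^°) _ _).
  - by apply: open_closedC; exact: open_interior.
  - by apply; exact: uW.
  exists f; split => // [|x Wx]; first by apply: f0; exists (u n).
  by apply: f1; exists x => // /interior_subset.
(* [h] is the sum of the functions [n%:R * (1 - f n)], of which at most one
   does not vanish at [x]. If no [W n] contains [x], then [idx x] is the default
   0, whose factor [0%:R] makes [h x] vanish. *)
pose idx x := xget 0%N [set n | W n x].
pose h x := (idx x)%:R * (1 - f (idx x) x).
have idxE x n : W n x -> idx x = n.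
  move=> Wx; rewrite /idx; have [M xM Muniq] := sep x.
  have Mx := nbhs_singleton xM.
  by case: xgetP => [m _ Wm|/(_ n)//]; exact: (Muniq _ _ x x).
have hloc (p : X) : exists n, \forall x \near p, h x = n%:R * (1 - f n x).
  have [M pM Muniq] := sep p.
  have [[n [y [My Wy]]]|none] := pselect (exists n y, M y /\ W n y).
    exists n; apply: filterS pM => x Mx; rewrite /h.
    have [[m Wm]|noW] := pselect (exists m, W m x).
      by rewrite (idxE _ _ Wm) (Muniq _ _ _ _ Mx My Wm Wy).
    have [_ _ ->] := fP n; last by move=> Wx; apply: noW; exists n.
    rewrite /idx; case: xgetP => [m _ Wm|_]; last by rewrite mul0r subrr mulr0.
    by case: noW; exists m.
  exists 0%N; apply: filterS pM => x Mx; rewrite /h /idx.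
  case: xgetP => [m _ Wm|_]; last by rewrite !mul0r.
  by case: none; exists m, x.
have hc : continuous h.
  move=> p; have [n hn] := hloc p.
  have [cf _ _] := fP n.
  have cg : {for p, continuous (fun x => n%:R * (1 - f n x))}.
    apply: cvgM; first exact: cvg_cst.
    by apply: cvgB; [exact: cvg_cst|exact: cf].
  rewrite /continuous_at (nbhs_singleton hn); apply: cvg_trans cg.
  by apply: near_eq_cvg; apply: filterS hn => x ->.
have [M [_ hM]] := pcX hc.
pose n := Num.bound `|M + 1|.
have Mn : M + 1 < n%:R by exact: le_lt_trans (ler_norm _) (archi_boundP _).
have hn : h (u n) = n%:R.
  have [_ fn0 _] := fP n; have Wn := nbhs_singleton (uW n).
  by rewrite /h (idxE _ _ Wn) fn0 subr0 mulr1.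
have M1 : M < M + 1 by rewrite ltrDl.
have := hM _ M1 (u n) I.
by rewrite /= hn ger0_norm // leNgt Mn.
Qed.

End Pseudocompact.

(** * Neighborhoods of the neutral element in a topological group *)

Section TopologicalGroup.
Variable G : preTopologicalGroupType.
Hypothesis tG : topological_group G.

Lemma mulg_continuousr (h : G) : continuous (fun g : G => g * h).
Proof.
move=> g; apply: (@continuous2_cvg _ _ _ _ _ _ id (fun=> h) (fun g h => g * h)).
- exact: tG.1 (g, h).
- exact: cvg_id.
- exact: cvg_cst.
Qed.

Lemma nbhs_div1 (h : G) (N : set G) : nbhs 1 N -> nbhs h [set g | N (g / h)].
Proof. by move=> N1; apply: (@mulg_continuousr h^-1 h); rewrite mulgV. Qed.

Lemma nbhs1_mulr (g : G) (N : set G) : nbhs g N -> nbhs 1 [set n | N (n * g)].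
Proof. by move=> gN; apply: (@mulg_continuousr g 1); rewrite mul1g. Qed.

Lemma div_nbhs1 (N : set G) : nbhs 1 N ->
  exists2 C, nbhs 1 C & forall x y, C x -> C y -> N (x / y).
Proof.
move=> N1; have : nbhs (1 * 1 : G) N by rewrite mulg1.
move=> /(tG.1 (1, 1)) [[P Q] [/= P1 Q1] PQ].
exists (P `&` [set x | Q x^-1]).
  by apply: filterI => //; apply: tG.2; rewrite invg1.
by move=> x y [Px _] [_ Qy]; exact: (PQ (x, y^-1)).
Qed.

End TopologicalGroup.

(** * Density of the semigroup and compactness of the group *)

Section CompactFractions.
Variables (R : realType) (S : ccTopologicalSemigroupType).
Hypotheses (hS : hausdorff_space S) (lS : locally_compact [set: S]).
Hypotheses (pS : pseudocompact R S) (oS : open_shifts S).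
Local Notation G := (topFractions S).
Local Notation iota := (@topFrac_iota S).

Let tG : topological_group G := topFrac_topological_group oS.

Let iota_nbhs (s : S) (N : set G) : nbhs 1 N ->
  nbhs s [set x | N (iota x / iota s)].
Proof. by move=> /(nbhs_div1 tG (iota s)); exact: topFrac_iota_continuous. Qed.

(** If both x / s and y / s, and x / u_i and y / u_j, are small, then so is
    u_j / u_i, which is a combination of the four of them. *)
Lemma topFrac_close_terms (u : nat -> S) (N : set G) : nbhs 1 N ->
  exists i j, (i < j)%N /\ N (iota (u j) / iota (u i)).
Proof.
move=> /(div_nbhs1 tG)[B /(div_nbhs1 tG)[C C1 CB] BN].
have crS : completely_regular_space S.
  exact: (@locally_compact_completely_regular S R).
have [s sP] := pseudocompact_accumulation crS pS (fun n => iota_nbhs (u n) C1).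
have [i [j [x [y [ij [Cx Cy] Ci Cj]]]]] := sP _ (iota_nbhs s C1).
exists i, j; split => //.
rewrite -(mulgKA (iota s)^-1).
rewrite -(topFrac_divKr (iota y) _ (iota s)).
rewrite -(topFrac_divKr (iota x) (iota (u i)) (iota s)).
by apply: BN; exact: CB.
Qed.

(** It suffices to approximate 1 / t by elements w of S. Two odd powers of t
    that are close to each other have a quotient t w close to 1, with w in S
    because distinct odd exponents differ by at least 2. *)
Lemma range_topFrac_iota_dense : dense (range iota).
Proof.
move=> O [g Og] oO; have [s [t gE]] := topFracP g.
have N1 : nbhs 1 [set n | O (n * g)].
  by apply: (nbhs1_mulr tG); exact: open_nbhs_nbhs.
pose u n := iter n (fun x => x * (t * t)) t.
have uS n : u n.+1 = u n * (t * t) by [].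
have [i [j [ij]]] := topFrac_close_terms u N1.
have [w ->] : exists w, u j = u i * (t * w).
  rewrite -(subnKC ij); elim: (j - i.+1)%N => [|m [w IH]].
    by exists t; rewrite addn0.
  by exists (w * (t * t)); rewrite addnS uS IH !mulgA.
rewrite /= topFrac_iotaM [_ / _]topFrac_mulC mulKg gE => Ow.
exists (iota (w * s)); split; last by exists (w * s).
suff -> : iota (w * s) = iota (t * w) * (iota s / iota t) by [].
by rewrite mulgA -topFrac_iotaM; apply/topFrac_iota_eq; smul_ac.
Qed.

(** Otherwise some sequence in S has no term close to an earlier one. *)
Lemma topFrac_totally_bounded (N : set G) : nbhs 1 N ->
  exists l : seq S, forall s, exists2 t, t \in l & N (iota s / iota t).
Proof.
move=> N1; apply: contrapT => nol.
have [next nextP] : {next : seq S -> S & forall l t,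
    t \in l -> ~ N (iota (next l) / iota t)}.
  apply: (@choice _ _ (fun l s => forall t, t \in l -> ~ N (iota s / iota t))).
  move=> l; apply: contrapT => nos; apply: nol; exists l => s.
  apply: contrapT => not; apply: nos; exists s => t tl Nst.
  by apply: not; exists t.
pose L n := iter n (fun l => next l :: l) [::].
have [i [j [ij]]] := topFrac_close_terms (next \o L) N1.
apply: nextP; rewrite -(subnKC ij); elim: (j - i.+1)%N => [|m IH].
  by rewrite addn0 mem_head.
by rewrite addnS in_cons IH orbT.
Qed.

(** Let C be a neighborhood of 1 with C / C inside K / a, where K is a compact
    neighborhood of a. Every g is s / c with s in S and c in C by density, and
    s = c' t with c' in C and t in a finite list. So g = (c' / c) t lies in
    one of the finitely many compact sets K t / a. *)
Lemma topFractions_compact : compact [set: G].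
Proof.
have a := xchoose (@semigroup_nonempty S).
have [K aK cK] := (locally_compactTP hS).1 lS a.
have K1 : nbhs 1 [set g | exists2 k, K k & g = iota k / iota a].
  have : nbhs (iota a) (iota @` K).
    move: aK; rewrite !nbhsE => -[B [oB Ba] BK]; exists (iota @` B).
      by split; [exact: topFrac_iota_open|exists a].
    exact: image_subset.
  move=> /(nbhs1_mulr tG); apply: filterS => g [k Kk kga].
  by exists k; rewrite // kga mulgK.
have [C C1 CK] := div_nbhs1 tG K1.
have [l lP] := topFrac_totally_bounded C1.
pose F t := [set iota k * (iota t / iota a) | k in K].
suff -> : [set: G] = \big[setU/set0]_(t <- l) F t.
  apply: bigsetU_compact => t _; apply: continuous_compact => //.
  apply: continuous_subspaceT.
  move=> x; apply: (@continuous_comp _ _ _ iota (fun g => g * _)).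
    exact: topFrac_iota_continuous.
  exact: (mulg_continuousr tG).
apply/seteqP; split => // g _; rewrite -bigcup_seq.
have [h [Ch [s _ sh]]] : ((interior [set h | C (h / g)]) `&` range iota) !=set0.
  apply: range_topFrac_iota_dense; last exact: open_interior.
  by exists g; exact: (nbhs_div1 tG).
have {Ch} := interior_subset Ch; rewrite -sh /= => Cs.
have [t tl Ct] := lP s.
have [k Kk kE] := CK _ _ Ct Cs.
exists t => //; exists k => //.
rewrite (topFrac_mulC (iota t)) mulgA -kE topFrac_divKr; exact: mulgVK.
Qed.
End CompactFractions.

Theorem theorem3p8 (R : realType) (S : ccTopologicalSemigroupType)
    (hausdorffS : hausdorff_space S)
    (locally_compactS : locally_compact [set: S])
    (pseudocompactS : pseudocompact R S)
    (open_shiftsS : open_shifts S) :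
  [/\ homeomorphism_onto_image (@topFrac_iota S),
      subsemigroup (range (@topFrac_iota S)),
      open (range (@topFrac_iota S)),
      dense (range (@topFrac_iota S)) &
      compact [set: topFractions S] /\ topological_group (topFractions S)].
Proof.
split.
- exact: topFrac_iota_homeomorphism.
- have a := xchoose (@semigroup_nonempty S).
  split; first by exists (topFrac_iota a); exists a.
  by move=> _ _ [x _ <-] [y _ <-]; exists (x * y) => //; exact: topFrac_iotaM.
- by apply: topFrac_iota_open => //; exact: openT.
- exact: range_topFrac_iota_dense pseudocompactS _.
- split; last exact: topFrac_topological_group.
  exact: topFractions_compact pseudocompactS _.
Qed.
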